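(* Let $\mathbf{TR}=t_0t_1t_2\cdots=0102010\cdots$ be the Tribonacci word, the fixed point of the morphism $0\mapsto01$, $1\mapsto02$, $2\mapsto0$. For $i\ge0$, $m,n\ge1$, let $A(i,m,n)=(t_{i+k+\ell})_{0\le k<m,0\le\ell<n}$ and for a letter $c$ let $|A(i,m,n)|_c$ be the number of entries equal to $c$. Say the $m\times n$ rectangles are $2$-balanced if $\big||A(i,m,n)|_c-|A(j,m,n)|_c\big|\le 2$ for all $i,j\ge0$ and all $c\in\{0,1,2\}$. Assume $m\le n$. Then: (a) if $m=1$, the $m\times n$ rectangles are $2$-balanced; (b) if $m=2$, there is a deterministic finite automaton with $77$ states that, reading the Tribonacci representation of $n$ (most significant digit first), accepts exactly those $n$ for which the $2\times n$ rectangles are $2$-balanced; (c) if $m\ge3$, there is no $n$ for which the $m\times n$ rectangles are $2$-balanced.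
   Context: Tribonacci numbers used for representation: $1,2,4,7,13,24,\ldots$ (each the sum of the previous three). Every $N\ge0$ is uniquely a sum of distinct such numbers whose binary digit word (most significant first) contains no block $111$; this word is the Tribonacci representation of $N$. *)

(* Defs.v *)
From mathcomp Require Import all_boot all_order all_algebra.

Set Implicit Arguments.
Unset Strict Implicit.
Unset Printing Implicit Defensive.

Import Order.TTheory GRing.Theory Num.Theory.

Definition letter := 'I_3.

Definition l0 : letter := @Ordinal 3 0 isT.
Definition l1 : letter := @Ordinal 3 1 isT.
Definition l2 : letter := @Ordinal 3 2 isT.

Definition trib_morph (c : letter) : seq letter :=
  match val c with
  | 0 => [:: l0; l1]
  | 1 => [:: l0; l2]
  | _ => [:: l0]
  end.

Definition trib_subst (w : seq letter) : seq letter :=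
  flatten (map trib_morph w).

(* The words [iter n trib_subst [:: l0]] are nested prefixes of one infinite
   word, and the n-th one has more than n letters, so the default [l0] is never
   used. *)
Definition TR (n : nat) : letter :=
  nth l0 (iter n trib_subst [:: l0]) n.

(* The image of every prefix of [t] under the morphism is a prefix of [t]. *)
Definition fixed_point (t : nat -> letter) : Prop :=
  forall k, let w := trib_subst (mkseq t k) in prefix w (mkseq t (size w)).

Lemma trib_subst_cat u v : trib_subst (u ++ v) = trib_subst u ++ trib_subst v.
Proof. by rewrite /trib_subst map_cat flatten_cat. Qed.

Lemma trib_subst_prefix u v : prefix u v -> prefix (trib_subst u) (trib_subst v).
Proof. by case/prefixP => s ->; rewrite trib_subst_cat prefix_prefix. Qed.

Lemma size_trib_subst w : size w <= size (trib_subst w).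
Proof.
elim: w => //= c w IH; rewrite /trib_subst /= size_cat -add1n leq_add //.
by case: c => [[|[|c]] hc].
Qed.

Lemma trib_iter_prefixS n :
  prefix (iter n trib_subst [:: l0]) (iter n.+1 trib_subst [:: l0]).
Proof. by elim: n => [|n IH] //; exact: trib_subst_prefix IH. Qed.

Lemma trib_iter_prefix m n : m <= n ->
  prefix (iter m trib_subst [:: l0]) (iter n trib_subst [:: l0]).
Proof.
move/subnK <-; elim: (n - m) => [|d IH]; first exact: prefix_refl.
exact: prefix_trans IH (trib_iter_prefixS _).
Qed.

Lemma trib_iter_head n : exists s, iter n trib_subst [:: l0] = l0 :: s.
Proof.
elim: n => [|n [s IH]]; first by exists [::].
by rewrite iterS IH; exists (l1 :: trib_subst s).
Qed.

Lemma size_trib_iter n : n < size (iter n trib_subst [:: l0]).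
Proof.
elim: n => [//|n IH]; rewrite iterS.
have [s E] := trib_iter_head n; rewrite E in IH *.
rewrite /= !ltnS in IH *.
exact: leq_trans IH (size_trib_subst s).
Qed.

Lemma TR_nth n k : k < size (iter n trib_subst [:: l0]) ->
  TR k = nth l0 (iter n trib_subst [:: l0]) k.
Proof.
have sz := size_trib_iter k; rewrite /TR => hk.
case: (leqP k n) => [kn|/ltnW nk].
  by have /prefixP[s ->] := trib_iter_prefix kn; rewrite nth_cat sz.
by have /prefixP[s ->] := trib_iter_prefix nk; rewrite nth_cat hk.
Qed.

Lemma TR_prefix n k : k <= size (iter n trib_subst [:: l0]) ->
  mkseq TR k = take k (iter n trib_subst [:: l0]).
Proof.
move=> hk; apply: (@eq_from_nth _ l0); first by rewrite size_mkseq size_takel.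
move=> i; rewrite size_mkseq => hi.
by rewrite nth_mkseq // nth_take // (@TR_nth n) // (leq_trans hi).
Qed.

Lemma TR_fixed_point : fixed_point TR.
Proof.
move=> k; cbv zeta; set w := trib_subst _; have hk := ltnW (size_trib_iter k).
have pr : prefix w (iter k.+1 trib_subst [:: l0]).
  by rewrite iterS; apply: trib_subst_prefix; rewrite (TR_prefix hk) prefix_take.
rewrite (TR_prefix (size_prefix pr)).
by move: pr; rewrite prefixE => /eqP ->; exact: prefix_refl.
Qed.

Definition rectangle (i m n : nat) : 'M[letter]_(m, n) :=
  \matrix_(k < m, l < n) TR (i + k + l).

Definition count_letter (m n : nat) (A : 'M[letter]_(m, n)) (c : letter) : nat :=
  #|[set kl : 'I_m * 'I_n | A kl.1 kl.2 == c]|.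

Definition two_balanced (m n : nat) : Prop :=
  forall (i j : nat) (c : letter),
    (`|(count_letter (rectangle i m n) c)%:Z
       - (count_letter (rectangle j m n) c)%:Z| <= 2%:Z)%R.

(* [trib_num] is 1, 2, 4, 7, 13, 24, ...: [trib_triple k] holds the terms
   of indices k, k+1 and k+2. *)
Fixpoint trib_triple (k : nat) : nat * nat * nat :=
  if k is k'.+1 then
    let: (a, b, c) := trib_triple k' in (b, c, a + b + c)
  else (1, 2, 4).

Definition trib_num (k : nat) : nat := (trib_triple k).1.1.

(* Words of binary digits, most significant first. *)
Definition trib_value (w : seq bool) : nat :=
  \sum_(k < size w) nth false (rev w) k * trib_num k.

(* Leading zeros are excluded, so 0 is represented by the empty word. *)
Definition trib_rep (n : nat) (w : seq bool) : bool :=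
  [&& head true w, ~~ infix [:: true; true; true] w & trib_value w == n].

Record dfa (char : Type) := Dfa {
  dfa_state :> finType;
  dfa_init : dfa_state;
  dfa_final : {set dfa_state};
  dfa_trans : dfa_state -> char -> dfa_state
}.

Definition dfa_accept (char : Type) (M : dfa char) (w : seq char) : bool :=
  foldl (@dfa_trans char M) (dfa_init M) w \in dfa_final M.

(* Main.v *)
From Stdlib Require Import ZArith.
Require Import Defs.
From mathcomp Require Import all_boot all_order all_algebra.
From mathcomp Require Import zify ssrZ.

(* Write P(n) for the letter counts of the prefix of length n.  The number of
   letters c in an m x n rectangle is a sum of P(i+k+n) - P(i+k) over k < m, so
   for a fixed small m it is read off t_i, t_{i+n} and P(i+n) - P(i) - P(n).
   Since TR is fixed by the morphism tau, every position is |tau(t_0...t_{p-1})|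
   plus 0 or 1, and appending a digit d to a representation of n gives a
   representation of |tau(t_0...t_{n-1})| + d.  Hence the set of all triples
   (t_i, t_j, P(j) - P(i) - P(n)), without those that can no longer reach
   j = i + n, is obtained from n by a subset construction on the digits; it has
   finitely many states, and each of them decides the cases m <= 2 and contains
   a witness against balance for m = 3 and m = 4.  When m, n >= 5, compare two
   rectangles whose antidiagonals read 02010w and 10201w, both words being
   factors of TR for arbitrarily long w: they differ only in the top left
   triangle, where their numbers of zeros are 9 and 6. *)

Set Implicit Arguments.
Unset Strict Implicit.
Unset Printing Implicit Defensive.

(* MathComp takes %Z for int. *)
Delimit Scope Z_scope with coqZ.

(** * Letter counts of prefixes and the blocks tau(t_p) *)

Definition letter_at (i : nat) : nat := TR i.

Definition pcount (c n : nat) : nat :=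
  count (fun x : letter => val x == c) (mkseq TR n).

Definition image_size (n : nat) : nat := size (trib_subst (mkseq TR n)).

Lemma letter_at_lt3 i : letter_at i < 3. Proof. exact: ltn_ord. Qed.

Lemma pcountS c n : pcount c n.+1 = pcount c n + (letter_at n == c).
Proof. by rewrite /pcount mkseqS -cats1 count_cat /= addn0. Qed.

Lemma pcount_sum n : pcount 0 n + pcount 1 n + pcount 2 n = n.
Proof.
elim: n => // n; rewrite !pcountS.
by have := letter_at_lt3 n; case: (letter_at n) => [|[|[|k]]] //= _; lia.
Qed.

Lemma mkseq_image_size n : mkseq TR (image_size n) = trib_subst (mkseq TR n).
Proof.
have /= := TR_fixed_point n; rewrite prefixE => /eqP.
by rewrite take_oversize // size_mkseq.
Qed.

(** Each image 01, 02, 0 has exactly one 0; a 1 comes only from the letter 0, and a 2 only from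
    1. *)
Lemma count_trib_subst (w : seq letter) (c : nat) :
  count (fun x : letter => val x == c) (trib_subst w) =
  match c with
  | 0 => size w
  | c'.+1 => if c' < 2 then count (fun x : letter => val x == c') w else 0
  end.
Proof.
elim: w => [|a w IH]; first by case: c => [|c] //=; case: ifP.
have -> : trib_subst (a :: w) = trib_morph a ++ trib_subst w by [].
rewrite count_cat {}IH; case: a => [[|[|[|a]]] ha] //;
  by case: c => [|[|[|c]]] //=; lia.
Qed.

Lemma pcount0_image n : pcount 0 (image_size n) = n.
Proof. by rewrite /pcount mkseq_image_size count_trib_subst size_mkseq. Qed.

Lemma pcount1_image n : pcount 1 (image_size n) = pcount 0 n.
Proof. by rewrite /pcount mkseq_image_size count_trib_subst. Qed.

Lemma pcount2_image n : pcount 2 (image_size n) = pcount 1 n.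
Proof. by rewrite /pcount mkseq_image_size count_trib_subst. Qed.

Lemma image_sizeE n : image_size n = n + pcount 0 n + pcount 1 n.
Proof.
rewrite -{1}(pcount_sum (image_size n)).
by rewrite pcount0_image pcount1_image pcount2_image.
Qed.

Lemma image_sizeS n :
  image_size n.+1 = image_size n + (if letter_at n < 2 then 2 else 1).
Proof.
rewrite !image_sizeE !pcountS.
by have := letter_at_lt3 n; case: (letter_at n) => [|[|[|k]]] //= _; lia.
Qed.

Lemma TR_image n k : k < size (trib_morph (TR n)) ->
  TR (image_size n + k) = nth l0 (trib_morph (TR n)) k.
Proof.
move=> hk; have E := mkseq_image_size n.+1.
have S : size (trib_subst (mkseq TR n.+1)) = image_size n + size (trib_morph (TR n)).
  by rewrite mkseqS -cats1 trib_subst_cat size_cat /trib_subst /= cats0.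
have lt : image_size n + k < image_size n.+1 by rewrite /image_size S ltn_add2l.
rewrite -(nth_mkseq l0 TR lt) E mkseqS -cats1 trib_subst_cat nth_cat.
by rewrite -/(image_size n) ltnNge leq_addr /= addKn /trib_subst /= cats0.
Qed.

Lemma letter_image n : letter_at (image_size n) = 0.
Proof.
have := @TR_image n 0; rewrite addn0 /letter_at.
by case: (TR n) => [[|[|[|a]]] ha] //= ->.
Qed.

Lemma letter_image1 n : letter_at n < 2 ->
  letter_at (image_size n + 1) = (letter_at n).+1.
Proof.
have := @TR_image n 1; rewrite /letter_at.
by case: (TR n) => [[|[|[|a]]] ha] //= ->.
Qed.

Definition in_block (p : nat) (u : bool) : bool := u ==> (letter_at p < 2).

(** The blocks tau(t_p) tile the word. The last clause makes the parent p smaller than n except at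
    0, so inductions can descend to parents. *)
Lemma image_size_cover n : exists p (u : bool),
  [/\ n = image_size p + u, in_block p u & (p < n) || (n == 0)].
Proof.
elim: n => [|n [p [u [En hu hp]]]]; first by exists 0, false.
have h : p <= image_size p by rewrite image_sizeE; lia.
have [lt2|ge2] := boolP (~~ u && (letter_at p < 2)).
  exists p, true; case: u En hu hp lt2 => //= -> _ hp lt2; split=> //; lia.
have {}hp : p < n.
  case/orP: hp => // /eqP n0; move: En ge2; rewrite n0 image_sizeE.
  by case: (posnP p) => [->|]; [case: u {hu}|lia].
exists p.+1, false; split=> //; last by rewrite orbF.
rewrite image_sizeS En; move: hu ge2; rewrite /in_block.
by case: u {En} => /=; case: (letter_at p < 2) => //; lia.
Qed.

Lemma letter_block p (u : bool) : in_block p u ->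
  letter_at (image_size p + u) = if u then (letter_at p).+1 else 0.
Proof. by case: u => /= h; [apply: letter_image1 | rewrite addn0 letter_image]. Qed.

Lemma pcount_block p (u : bool) :
  [/\ pcount 0 (image_size p + u) = p + u,
      pcount 1 (image_size p + u) = pcount 0 p &
      pcount 2 (image_size p + u) = pcount 1 p].
Proof.
have := (pcount0_image p, pcount1_image p, pcount2_image p).
case: u; rewrite ?addn0 ?addn1 ?pcountS ?letter_image /= => -[[-> ->] ->];
  split; lia.
Qed.

(** * Tribonacci values of digit words *)

Lemma trib_numE k : trib_num k.+3 = trib_num k + trib_num k.+1 + trib_num k.+2.
Proof. by rewrite /trib_num /=; case: (trib_triple k) => [[a b] c]. Qed.

(* The sequence trib_num with 0, 0, 1 put in front, so that pcount c of a
   represented number is the value of its digits with indices shifted. *)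
Definition trib_ext (k : nat) : nat := nth (trib_num (k - 3)) [:: 0; 0; 1] k.

Lemma trib_extE k : trib_ext k.+3 = trib_ext k + trib_ext k.+1 + trib_ext k.+2.
Proof.
by case: k => [|[|[|k]]] //; rewrite /trib_ext /= !nth_nil !subSS !subn0 trib_numE.
Qed.

Definition ext_value (j : nat) (w : seq bool) : nat :=
  \sum_(k < size w) nth false (rev w) k * trib_ext (k + j).

Lemma ext_value_rcons j w (d : bool) :
  ext_value j (rcons w d) = d * trib_ext j + ext_value j.+1 w.
Proof.
rewrite /ext_value size_rcons big_ord_recl rev_rcons /=; congr (_ + _).
by apply: eq_bigr => i _; rewrite /bump /= add1n addSnnS.
Qed.

Lemma ext_valueE j w :
  ext_value j.+3 w = ext_value j w + ext_value j.+1 w + ext_value j.+2 w.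
Proof.
rewrite /ext_value -!big_split /=; apply: eq_bigr => i _.
by rewrite !addnS trib_extE !mulnDr.
Qed.

Lemma ext_value_trib w : ext_value 3 w = trib_value w.
Proof.
by apply: eq_bigr => i _; rewrite addnC /trib_ext /= nth_nil subSS subSS subSS subn0.
Qed.

(* No condition on w: a block 111 is allowed. *)
Lemma pcount_trib_value w :
  [/\ pcount 0 (trib_value w) = ext_value 2 w,
      pcount 1 (trib_value w) = ext_value 1 w,
      pcount 2 (trib_value w) = ext_value 0 w &
      forall d : bool, trib_value (rcons w d) = image_size (trib_value w) + d].
Proof.
(* [ext_value 4] is the sum of [ext_value] at 3, 2 and 1, that is n plus its zeros and ones, which
   is the image length. *)
have rc v d : pcount 0 (trib_value v) = ext_value 2 v ->
    pcount 1 (trib_value v) = ext_value 1 v ->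
    pcount 2 (trib_value v) = ext_value 0 v ->
    trib_value (rcons v d) = image_size (trib_value v) + d.
  move=> e0 e1 e2; rewrite image_sizeE e0 e1 -!ext_value_trib ext_value_rcons.
  rewrite (ext_valueE 1) ext_valueE.
  move: (ext_value 0 v) (ext_value 1 v) (ext_value 2 v) => a b c.
  by rewrite /trib_ext /= /trib_num /=; lia.
elim/last_ind: w => [|w d [e0 e1 e2 e3]]; last first.
  have [f0 f1 f2] := pcount_block (trib_value w) d.
  have H : [/\ pcount 0 (trib_value (rcons w d)) = ext_value 2 (rcons w d),
      pcount 1 (trib_value (rcons w d)) = ext_value 1 (rcons w d) &
      pcount 2 (trib_value (rcons w d)) = ext_value 0 (rcons w d)].
    rewrite e3 f0 f1 f2 !ext_value_rcons e0 e1 ext_value_trib /trib_ext /=.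
    by split; lia.
  by case: H => h0 h1 h2; split=> // d'; apply: rc.
have H : [/\ pcount 0 (trib_value [::]) = ext_value 2 [::],
    pcount 1 (trib_value [::]) = ext_value 1 [::] &
    pcount 2 (trib_value [::]) = ext_value 0 [::]].
  by rewrite /trib_value /ext_value /= !big_ord0.
by case: H => h0 h1 h2; split=> // d; apply: rc.
Qed.

Lemma trib_value_rcons w (d : bool) :
  trib_value (rcons w d) = image_size (trib_value w) + d.
Proof. by have [_ _ _] := pcount_trib_value w. Qed.

Lemma trib_value_nil : trib_value [::] = 0. Proof. exact: big_ord0. Qed.

Lemma trib_value_true : trib_value [:: true] = 1.
Proof. by rewrite (trib_value_rcons [::] true) trib_value_nil. Qed.

Lemma trib_value_surj n : 1 <= n -> exists w, trib_value (true :: w) = n.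
Proof.
have [m] := ubnP n; elim: m n => // m IH n nm n0.
have [p [u [En hu]]] := image_size_cover n; rewrite (gtn_eqF n0) orbF => pn.
case: (posnP p) => [p0|p1].
  exists [::]; rewrite trib_value_true; by move: n0; rewrite En p0; case: (u).
have [w hw] := IH p (leq_trans pn nm) p1.
by exists (rcons w u); rewrite -rcons_cons trib_value_rcons hw.
Qed.

(** * Patterns and the subset construction on digits *)

(* (t_i, t_j, P(j) - P(i) - P(n)), see pattern_at. *)
Definition pattern : Type := nat * nat * (Z * Z * Z).

(* If (x, y, z) is the difference vector of the parent, that of a child is
   (x + y + z + c, x, y) with -2 <= c <= 1; both half-cones below are stable
   under these maps and contain no vector with x + y + z = 0. *)
Definition escaped (e : pattern) : bool :=
  let: (_, (x, y, z)) := e in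
  ((1 <=? x) && (3 <=? x + y + z) && (5 <=? x + x + y + y + z) ||
   (x <=? -1) && (x + y + z <=? -2) && (x + x + y + y + z <=? -3))%coqZ.

Definition kids (a : nat) : seq (bool * nat) :=
  if a < 2 then [:: (false, 0); (true, a.+1)] else [:: (false, 0)].

(** By [pcount_block], a prefix of the image has as many zeros as its parent has letters, plus the
    offset; its ones and twos are the parent's zeros and ones. Hence the shift of coordinates. *)
Definition child (d : bool) (e : pattern) (p q : bool * nat) : pattern :=
  let: (_, (x, y, z)) := e in
  (p.2, q.2, (x + y + z + (Z.b2z q.1 - Z.b2z p.1 - Z.b2z d), x, y))%coqZ.

Definition children (d : bool) (e : pattern) : seq pattern :=
  [seq child d e p q | p <- kids e.1.1, q <- kids e.1.2].

(* No property of this order is used in proofs: sorting turns equal sets into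
   equal lists, which keeps the number of nodes visited by explore finite. *)
Definition lex_le (e f : pattern) : bool :=
  let: (a, b, (x, y, z)) := e in
  let: (a', b', (x', y', z')) := f in
  if (x ?= x')%coqZ is Eq then
    if (y ?= y')%coqZ is Eq then
      if (z ?= z')%coqZ is Eq then
        if a == a' then b <= b' else a < a'
      else (z <=? z')%coqZ
    else (y <=? y')%coqZ
  else (x <=? x')%coqZ.

Fixpoint dedup (T : eqType) (s : seq T) : seq T :=
  if s is x :: s' then
    let s'' := dedup s' in
    if s'' is y :: _ then if x == y then s'' else x :: s'' else [:: x]
  else [::].

Definition step (d : bool) (S : seq pattern) : seq pattern :=
  dedup (sort lex_le (filter (predC escaped) (flatten (map (children d) S)))).

Definition pattern0 : pattern := (0, 0, (0, 0, 0)%coqZ).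

(* The set of patterns for n = 0; it is stable after 8 steps. *)
Definition patterns0 : seq pattern := iter 8 (step false) [:: pattern0].

(** The coordinates sum to j - i - n, so the test selects j = i + n. *)
Definition zero_sum (e : pattern) : bool :=
  let: (_, (x, y, z)) := e in (x + y + z =? 0)%coqZ.

Definition comp (c : nat) (e : pattern) : Z :=
  let: (_, (x, y, z)) := e in match c with 0 => x | 1 => y | _ => z end.

Definition ind (a c : nat) : Z := Z.b2z (a == c).

Definition count1 (c : nat) (e : pattern) : Z := comp c e.

(** Excess over 2 P(n) of a two-row count: the second window drops t_i and gains t_{i+n}. *)
Definition count2 (c : nat) (e : pattern) : Z :=
  (2 * comp c e + ind e.1.2 c - ind e.1.1 c)%coqZ.

Definition balanced (f : nat -> pattern -> Z) (S : seq pattern) : bool :=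
  let E := filter zero_sum S in
  all (fun c => let vs := map (f c) E in
    all (fun x => all (fun y => x <=? y + 2)%coqZ vs) vs) [:: 0; 1; 2].

(* Bounds on the excess of P(q) + ... + P(q + m - 1) over m P(q) in the
   coordinate c, for m = 3 or 4 and the position q of offset u in the image of
   the letter a.  The letters at q and q + 1 are determined by a and u, and the
   letter at q + 2 is determined when u = 0. *)
Definition bounds (m : Z) (a : nat) (u : bool) (c : nat) : Z * Z :=
  let first := ind (if u then a.+1 else 0) c in
  let second := ind (if u then 0 else if a < 2 then a.+1 else 0) c in
  let third := ind (if a < 2 then 0 else 1) c in
  let v := (first * (m - 1) + second * (m - 2))%coqZ in
  (if u then (v, v + (m - 3))
   else (v + third * (m - 3), v + third * (m - 3)))%coqZ.

(** Parent and offsets are kept because [bounds] finds the following letters from the parent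
    letter. *)
Definition zero_children (d : bool) (S : seq pattern) :
    seq (pattern * (bool * nat) * (bool * nat)) :=
  [seq r <- flatten [seq [seq (e, p, q) | p <- kids e.1.1, q <- kids e.1.2]
                    | e <- S] | zero_sum (child d r.1.1 r.1.2 r.2)].

(** An interval containing the count of c minus m P(n), for the rectangle at the child position and
    n the child length. *)
Definition child_range (m : Z) (d : bool) (c : nat)
    (r : pattern * (bool * nat) * (bool * nat)) : Z * Z :=
  let: (e, p, q) := r in
  let A := bounds m e.1.1 p.1 c in
  let B := bounds m e.1.2 q.1 c in
  let x := (m * comp c (child d e p q))%coqZ in
  (x + B.1 - A.2, x + B.2 - A.1)%coqZ.

Definition unbalanced (m : Z) (d : bool) (S : seq pattern) : bool :=
  let C := zero_children d S in
  has (fun c => let vs := map (child_range m d c) C in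
     has (fun x => has (fun y => y.2 + 3 <=? x.1)%coqZ vs) vs) [:: 0; 1; 2].

(** * The automaton and the finite search *)

(* The minimal automaton for the two-row property over all binary words has 68
   states; the states 68, ..., 76 of automaton below are unreachable. *)
Definition table : seq (nat * nat) :=
  [:: (0, 1); (2, 3); (4, 5); (6, 3); (3, 7); (8, 9); (10, 5); (11, 12);
      (13, 5); (14, 12); (12, 15); (4, 16); (17, 18); (18, 19); (10, 16);
      (14, 12); (8, 20); (21, 22); (23, 9); (24, 12); (25, 26); (26, 15);
      (24, 27); (28, 5); (13, 16); (29, 30); (31, 18); (32, 33); (33, 34);
      (12, 35); (36, 37); (38, 22); (21, 39); (40, 41); (42, 12); (25, 26);
      (43, 21); (44, 45); (45, 15); (24, 46); (47, 22); (42, 27); (28, 16);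
      (18, 48); (29, 49); (50, 18); (51, 52); (52, 34); (53, 54); (36, 55);
      (50, 41); (56, 57); (58, 41); (43, 56); (59, 38); (60, 50); (26, 35);
      (61, 62); (63, 22); (21, 64); (29, 57); (43, 56); (51, 50); (50, 34);
      (53, 65); (66, 50); (21, 67); (53, 62)].

Definition accepting : seq nat :=
  [:: 0; 1; 2; 3; 4; 7; 8; 9; 10; 11; 20; 24; 29; 53].

Definition delta (q : nat) (d : bool) : nat :=
  let: (q0, q1) := nth (0, 0) table q in if d then q1 else q0.

Definition node : Type := nat * seq pattern.

Definition next_node (p : node) (d : bool) : node := (delta p.1 d, step d p.2).

Definition good (p : node) : bool :=
  [&& balanced count1 p.2, balanced count2 p.2 == (p.1 \in accepting) &
    all (fun d => unbalanced 3%coqZ d p.2 && unbalanced 4%coqZ d p.2)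
      [:: false; true]].

(** Depth-first search; n is fuel, and running out of it with nodes pending counts as failure. *)
Fixpoint explore (n : nat) (seen todo : seq node) : bool :=
  match todo, n with
  | [::], _ => true
  | p :: todo', n'.+1 =>
      if p \in seen then explore n' seen todo'
      else good p &&
        explore n' (p :: seen) (next_node p false :: next_node p true :: todo')
  | _, 0 => false
  end.

Definition node1 : node := next_node (0, patterns0) true.

(* The third test settles m = n = 3: since 3 = image_size 1 + 1, this n is not a
   child of a number reached from the two starting nodes, which represent 2 and
   3. *)
Definition all_checks : bool :=
  [&& pattern0 \in patterns0, step false patterns0 == patterns0,
      unbalanced 3%coqZ true node1.2 &
      explore 600 [::] [:: next_node node1 false; next_node node1 true]].

(** * Patterns of actual positions *)

Definition pcount_diff (c i j n : nat) : Z :=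
  (Z.of_nat (pcount c j) - Z.of_nat (pcount c i) - Z.of_nat (pcount c n))%coqZ.

Definition pattern_at (i j n : nat) : pattern :=
  (letter_at i, letter_at j,
   (pcount_diff 0 i j n, pcount_diff 1 i j n, pcount_diff 2 i j n)).

Lemma mem_kids p (u : bool) : in_block p u ->
  (u, letter_at (image_size p + u)) \in kids (letter_at p).
Proof.
move=> h; rewrite letter_block // /kids; move: h; rewrite /in_block.
by case: u; case: (letter_at p < 2) => //= _; rewrite !inE eqxx ?orbT.
Qed.

Lemma kids_block p (r : bool * nat) :
  r \in kids (letter_at p) -> in_block p r.1 /\ r.2 = letter_at (image_size p + r.1).
Proof.
rewrite /kids /in_block; case lt2: (letter_at p < 2); rewrite !inE.
  by case/orP => /eqP ->; rewrite letter_block.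
by move/eqP => ->; rewrite letter_block.
Qed.

Lemma child_pattern_at (d : bool) i j n (u v : bool) :
  child d (pattern_at i j n) (u, letter_at (image_size i + u))
    (v, letter_at (image_size j + v)) =
  pattern_at (image_size i + u) (image_size j + v) (image_size n + d).
Proof.
have [i0 i1 i2] := pcount_block i u; have [j0 j1 j2] := pcount_block j v.
have [n0 n1 n2] := pcount_block n d.
rewrite /pattern_at /child /pcount_diff i0 i1 i2 j0 j1 j2 n0 n1 n2 /=.
have := (pcount_sum i, pcount_sum j, pcount_sum n) => -[[si sj] sn].
congr (_, _, (_, _, _)).
by case: u {i0 i1 i2}; case: v {j0 j1 j2}; case: d {n0 n1 n2} => /=; lia.
Qed.

Lemma mem_children (d : bool) i j n (u v : bool) : in_block i u -> in_block j v ->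
  pattern_at (image_size i + u) (image_size j + v) (image_size n + d)
    \in children d (pattern_at i j n).
Proof.
move=> hu hv; rewrite -child_pattern_at.
by apply: (allpairs_f (child d (pattern_at i j n))); apply: mem_kids.
Qed.

Lemma children_pattern_at (d : bool) i j n e : e \in children d (pattern_at i j n) ->
  exists i' j', e = pattern_at i' j' (image_size n + d).
Proof.
case/allpairsP => -[[u a] [v b]] [/kids_block [_ /= Ea] /kids_block [_ /= Eb] ->].
exists (image_size i + u), (image_size j + v).
by rewrite -child_pattern_at -Ea -Eb.
Qed.

Lemma zero_sumE i j n : zero_sum (pattern_at i j n) = (j == i + n).
Proof.
rewrite /zero_sum /pattern_at /pcount_diff.
have := (pcount_sum i, pcount_sum j, pcount_sum n) => -[[si sj] sn].
by apply/idP/idP => /= [|/eqP E]; [lia | apply/Z.eqb_eq; lia].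
Qed.

Lemma zero_sum_kept e : zero_sum e -> ~~ escaped e.
Proof. by case: e => [[a b] [[x y] z]] /=; lia. Qed.

Lemma escaped_child d e p q : escaped e -> escaped (child d e p q).
Proof.
case: e => [[a b] [[x y] z]]; case: p => [u a']; case: q => [v b'].
by case: u; case: v; case: d => /=; lia.
Qed.

Lemma mem_dedup (T : eqType) (s : seq T) : dedup s =i s.
Proof.
elim: s => // x s IH y; rewrite inE -IH /=.
case E : (dedup s) => [|z s'] /=; first by rewrite inE orbF.
by case: (x =P z) => [->|_]; rewrite !inE // orbA orbb.
Qed.

Lemma mem_step d S e :
  (e \in step d S) = ~~ escaped e && has (fun f => e \in children d f) S.
Proof.
rewrite /step mem_dedup mem_sort mem_filter /=; congr (_ && _).
by apply/flatten_mapP/hasP => -[f fS ef]; exists f.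
Qed.

(** Soundness: witnesses found in S are genuine. [describes] adds completeness up to escaped
    patterns, from which balance is deduced. *)
Definition realised (S : seq pattern) (n : nat) : Prop :=
  forall e, e \in S -> exists i j, e = pattern_at i j n.

Definition describes (S : seq pattern) (n : nat) : Prop :=
  realised S n /\
  forall i j, ~~ escaped (pattern_at i j n) -> pattern_at i j n \in S.

Lemma realised_step (d : bool) S n : realised S n ->
  realised (step d S) (image_size n + d).
Proof.
move=> h e; rewrite mem_step => /andP[_ /hasP[f /h [i [j ->]] ef]].
exact: children_pattern_at ef.
Qed.

Lemma mem_step_pattern_at (d : bool) S i j n (u v : bool) :
    in_block i u -> in_block j v ->
    ~~ escaped (pattern_at (image_size i + u) (image_size j + v) (image_size n + d)) ->
    (~~ escaped (pattern_at i j n) -> pattern_at i j n \in S) ->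
  pattern_at (image_size i + u) (image_size j + v) (image_size n + d) \in step d S.
Proof.
move=> hu hv nesc h; rewrite mem_step nesc /=; apply/hasP.
exists (pattern_at i j n).
  (* An escaped parent would have an escaped child. *)
  by apply: h; apply: contra nesc; rewrite -child_pattern_at; apply: escaped_child.
exact: mem_children.
Qed.

Lemma describes_step (d : bool) S n : describes S n ->
  describes (step d S) (image_size n + d).
Proof.
case=> hr hc; split=> [|i j]; first exact: realised_step.
have [p [u [-> hu _]]] := image_size_cover i.
have [q [v [-> hv _]]] := image_size_cover j.
by move=> ne; apply: mem_step_pattern_at => // /hc.
Qed.

(** The digit 0 maps n = 0 to itself, so its set must be stable. Every pair (i, j) descends to (0,
    0) through parents, and stability carries membership back up. *)
Lemma describes0 (S : seq pattern) k : S = iter k (step false) [:: pattern0] ->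
  pattern0 \in S -> step false S = S -> describes S 0.
Proof.
have is0 (u : bool) : image_size 0 + u = u by [].
move=> ES h0 hs; split.
  rewrite {}ES {h0 hs}; elim: k => [|k IH] e.
    by rewrite inE => /eqP ->; exists 0, 0.
  by rewrite iterS => /(realised_step IH); rewrite is0.
move=> i j; have [l] := ubnP (i + j); elim: l i j => // l IH i j lk.
have [p [u [Ei hu hp]]] := image_size_cover i.
have [q [v [Ej hv hq]]] := image_size_cover j.
have [/eqP|ij0] := boolP (i + j == 0).
  by move/eqP; rewrite addn_eq0 => /andP[/eqP -> /eqP ->].
have pi : p <= image_size p by rewrite image_sizeE; lia.
have qi : q <= image_size q by rewrite image_sizeE; lia.
have lt : p + q < l by lia.
have := @mem_step_pattern_at false S p q 0 u v hu hv.
by rewrite is0 hs -Ei -Ej => H ne; apply: H => // /(IH _ _ lt).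
Qed.

(** * Letter counts of rectangles with one or two rows *)

Lemma window_count (c : letter) i n :
  pcount c i + \sum_(l < n) (TR (i + l) == c) = pcount c (i + n).
Proof.
elim: n => [|n IH]; first by rewrite big_ord0 !addn0.
by rewrite big_ord_recr /= addnA IH addnS pcountS.
Qed.

(** Row k is the window of length n at i + k; the sum on the left replaces a subtraction in
    [nat]. *)
Lemma count_rectangle m n i (c : letter) :
  count_letter (rectangle i m n) c + \sum_(k < m) pcount c (i + k) =
  \sum_(k < m) pcount c (i + k + n).
Proof.
have -> : count_letter (rectangle i m n) c =
    \sum_(k < m) \sum_(l < n) (TR (i + k + l) == c).
  rewrite /count_letter cardsE -sum1_card pair_big /= [LHS]big_mkcond.
  apply: eq_bigr => -[k l] _; rewrite unfold_in mxE /=.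
  by rewrite -[eqn _ _]/(TR (i + k + l) == c); case: (_ == c).
rewrite addnC -big_split; apply: eq_bigr => k _; exact: window_count.
Qed.

Lemma two_balancedP m n : two_balanced m n <-> forall i j (c : letter),
  count_letter (rectangle i m n) c <= count_letter (rectangle j m n) c + 2.
Proof.
split=> h i j c; first by have := h i j c; lia.
by have := h i j c; have := h j i c; lia.
Qed.

(** The zero-sum members of S are exactly the patterns at (i, i + n), and m P(n) cancels in
    differences of counts. *)
Lemma balancedP f m n S : describes S n ->
    (forall i (c : letter), Z.of_nat (count_letter (rectangle i m n) c) =
       (Z.of_nat m * Z.of_nat (pcount c n)
        + f (c : nat) (pattern_at i (i + n) n))%coqZ) ->
  balanced f S <-> two_balanced m n.
Proof.
move=> [hr hc] hf; rewrite two_balancedP.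
have memS i : pattern_at i (i + n) n \in filter zero_sum S.
  have z : zero_sum (pattern_at i (i + n) n) by rewrite zero_sumE.
  by rewrite mem_filter z hc // zero_sum_kept.
split=> [/allP H i j c|H].
  have /H/allP Hc : (c : nat) \in [:: 0; 1; 2] by case: c => [[|[|[|c]]] ?].
  have /allP/(_ _ (map_f _ (memS j)))/Z.leb_le := Hc _ (map_f _ (memS i)).
  by have := (hf i c, hf j c) => -[]; lia.
apply/allP => c c012; have {c012} : exists c' : letter, c = c' :> nat.
  by case: c c012 => [|[|[|c]]] // _; [exists l0|exists l1|exists l2].
case=> c' ->; apply/allP => _ /mapP[e + ->].
rewrite mem_filter => /andP[ze /hr [i [i' ee]]].
apply/allP => _ /mapP[g + ->].
rewrite mem_filter => /andP[zg /hr [j [j' eg]]].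
move: ze zg; rewrite ee eg !zero_sumE => /eqP -> /eqP ->.
apply/Z.leb_le; have := H i j c'; have := (hf i c', hf j c') => -[]; lia.
Qed.

Lemma comp_pattern_at i j n (c : letter) :
  comp c (pattern_at i j n) = pcount_diff c i j n.
Proof. by case: c => [[|[|[|c]]] ?]. Qed.

Lemma count1P n i (c : letter) : Z.of_nat (count_letter (rectangle i 1 n) c) =
  (Z.of_nat 1 * Z.of_nat (pcount c n) + count1 c (pattern_at i (i + n) n))%coqZ.
Proof.
have H := count_rectangle 1 n i c.
rewrite !big_ord_recr !big_ord0 /= !addn0 in H.
by rewrite /count1 comp_pattern_at /pcount_diff; lia.
Qed.

Lemma indE a c : ind a c = Z.of_nat (a == c).
Proof. by rewrite /ind; case: (a == c). Qed.

Lemma count2_pattern_at i j n (c : letter) : count2 c (pattern_at i j n) =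
  (2 * pcount_diff c i j n + Z.of_nat (letter_at j == c)
   - Z.of_nat (letter_at i == c))%coqZ.
Proof. by rewrite /count2 comp_pattern_at !indE. Qed.

Lemma count2P n i (c : letter) : Z.of_nat (count_letter (rectangle i 2 n) c) =
  (Z.of_nat 2 * Z.of_nat (pcount c n) + count2 c (pattern_at i (i + n) n))%coqZ.
Proof.
have H := count_rectangle 2 n i c.
rewrite !big_ord_recr !big_ord0 /= !addn0 !addn1 addSn !pcountS in H.
by rewrite count2_pattern_at /pcount_diff; lia.
Qed.

(** * Imbalance with three or four rows *)

Definition shift_excess (m c p : nat) : Z :=
  (Z.of_nat (letter_at p == c) * (Z.of_nat m - 1)
   + Z.of_nat (letter_at p.+1 == c) * (Z.of_nat m - 2)
   + Z.of_nat (letter_at p.+2 == c) * (Z.of_nat m - 3))%coqZ.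

(** The letter at p + k is counted in m - 1 - k of the m prefixes. *)
Lemma sum_pcount m c p : (m == 3) || (m == 4) ->
  Z.of_nat (\sum_(k < m) pcount c (p + k)) =
  (Z.of_nat m * Z.of_nat (pcount c p) + shift_excess m c p)%coqZ.
Proof.
have E3 : \sum_(k < 3) pcount c (p + k) =
    pcount c p + (pcount c p + (letter_at p == c)) +
    (pcount c p + (letter_at p == c) + (letter_at p.+1 == c)).
  by rewrite !big_ord_recr !big_ord0 /= !(addn0, addnS) !pcountS.
have E4 : \sum_(k < 4) pcount c (p + k) =
    \sum_(k < 3) pcount c (p + k) +
    (pcount c p + (letter_at p == c) + (letter_at p.+1 == c) + (letter_at p.+2 == c)).
  by rewrite big_ord_recr /= !(addn0, addnS) !pcountS.
by rewrite /shift_excess; case/orP => /eqP ->; rewrite ?E4 E3; lia.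
Qed.

(** A nonzero letter is the second of its block, and the next block opens with 0. *)
Lemma letter_at_after_nonzero p : letter_at p != 0 -> letter_at p.+1 = 0.
Proof.
have [q [u [-> hu _]]] := image_size_cover p; rewrite letter_block //.
case: u hu => // hq _; have := image_sizeS q.
by rewrite (hq : letter_at q < 2) addn2 addn1 => <-; rewrite letter_image.
Qed.

Lemma boundsP m c p (u : bool) : (m == 3) || (m == 4) -> in_block p u ->
  let b := bounds (Z.of_nat m) (letter_at p) u c in
  (b.1 <= shift_excess m c (image_size p + u) <= b.2)%coqZ.
Proof.
move=> hm hu; rewrite /shift_excess /bounds letter_block //.
have h3 : (Z.of_nat m = 3 \/ Z.of_nat m = 4)%coqZ by lia.
have bnd x : (0 <= Z.of_nat (nat_of_bool x) <= 1)%coqZ by case: x.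
case: u hu => /= [lt2|_].
  have -> : letter_at (image_size p + 1).+1 = 0.
    by have := image_sizeS p; rewrite lt2 addn2 addn1 => <-; rewrite letter_image.
  have := bnd (letter_at (image_size p + 1).+2 == c).
  by rewrite !indE; case: h3 => ->; lia.
have := image_sizeS p; rewrite addn0; case: ifP => lt2; rewrite ?addn2 ?addn1 => E.
  have h1 : letter_at (image_size p).+1 = (letter_at p).+1.
    by rewrite -addn1 letter_image1.
  by rewrite h1 -E !letter_image !indE; case: h3 => ->; lia.
(* The block of 2 is the single letter 0, and the next block is 01, so the three letters are 0, 0,
   1. *)
have tp : letter_at p = 2 by have := letter_at_lt3 p; lia.
have tp1 : letter_at p.+1 = 0 by apply: letter_at_after_nonzero; rewrite tp.
have h1 : letter_at (image_size p.+1).+1 = 1 by rewrite -addn1 letter_image1 tp1.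
by rewrite -E h1 !letter_image !indE; case: h3 => ->; lia.
Qed.

Lemma child_range_pattern_at m (d : bool) (c : letter) i j n (u v : bool) :
  child_range m d c (pattern_at i j n, (u, letter_at (image_size i + u)),
    (v, letter_at (image_size j + v))) =
  let x := (m * pcount_diff c (image_size i + u) (image_size j + v)
                  (image_size n + d))%coqZ in
  ((x + (bounds m (letter_at j) v c).1 - (bounds m (letter_at i) u c).2)%coqZ,
   (x + (bounds m (letter_at j) v c).2 - (bounds m (letter_at i) u c).1)%coqZ).
Proof. by rewrite /child_range child_pattern_at comp_pattern_at. Qed.

(** Each zero-sum child occurs at actual positions, with its excess inside its interval; intervals
    at distance 3 give counts differing by at least 3. *)
Lemma unbalancedP m (d : bool) S n : (m == 3) || (m == 4) -> realised S n ->
  unbalanced (Z.of_nat m) d S -> ~ two_balanced m (image_size n + d).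
Proof.
move=> hm hr /hasP[c0 c012 /hasP[_ /mapP[e he ->] /hasP[_ /mapP[f hf ->] /Z.leb_le lt]]].
have [c Ec] : exists c : letter, c0 = c.
  by move: c012; rewrite !inE => /or3P[] /eqP ->; [exists l0|exists l1|exists l2].
have rng r : r \in zero_children d S -> exists i,
    let v := (Z.of_nat (count_letter (rectangle i m (image_size n + d)) c)
              - Z.of_nat m * Z.of_nat (pcount c (image_size n + d)))%coqZ in
    let b := child_range (Z.of_nat m) d c r in (b.1 <= v <= b.2)%coqZ.
  rewrite mem_filter => /andP[+ /flattenP[_ /mapP[g /hr [i [j ->]] ->]]].
  move=> + /allpairsP[[[u a] [v b]] [/kids_block [hu /= Ea] /kids_block [hv /= Eb] Er]].
  rewrite {}Er Ea Eb child_range_pattern_at.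
  rewrite -[(_, _, _).1.1]/(pattern_at i j n) child_pattern_at => z.
  exists (image_size i + u); have := z; rewrite zero_sumE /pcount_diff => /eqP ->.
  have := count_rectangle m (image_size n + d) (image_size i + u) c.
  have -> : \sum_(k < m) pcount c (image_size i + u + k + (image_size n + d)) =
      \sum_(k < m) pcount c (image_size j + v + k).
    move: z; rewrite zero_sumE => /eqP ->; apply: eq_bigr => k _.
    by congr (pcount _ _); lia.
  have := sum_pcount c (image_size i + u) hm.
  have := sum_pcount c (image_size j + v) hm.
  have := boundsP c hm hu; have := boundsP c hm hv => /=.
  move: z; rewrite zero_sumE => /eqP ->.
  set A := bounds _ _ u c; set B := bounds _ _ v c; lia.
move: lt; rewrite Ec => lt; have [i hi] := rng _ he; have [j hj] := rng _ hf.
by move/two_balancedP/(_ i j c); lia.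
Qed.

(** * Soundness of the search and runs of the automaton *)

Lemma exploreP n seen todo : explore n seen todo -> all good seen ->
    (forall p d, p \in seen -> next_node p d \in seen ++ todo) ->
  exists V : seq node, [/\ {subset seen ++ todo <= V}, all good V &
    forall p d, p \in V -> next_node p d \in V].
Proof.
(* Invariant: successors of seen nodes are seen or pending. Once nothing is pending, the seen nodes
   form a closed set of good nodes. *)
elim: n seen todo => [|n IH] seen [|p todo] //=;
  try by move=> _ hg hc; exists seen; split=> // [q|q d qs];
    [|have := hc q d qs]; rewrite cats0.
case: ifP => [ps|_].
  move=> he hg hc; have sub : {subset seen ++ p :: todo <= seen ++ todo}.
    by move=> q; rewrite !mem_cat inE => /or3P[->|/eqP ->|->]; rewrite ?ps ?orbT.
  have [|V [sV gV cV]] := IH _ _ he hg; first by move=> q d /(hc _ d)/sub.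
  by exists V; split=> // q /sub/sV.
case/andP=> gp he hg hc; have [||V [sV gV cV]] := IH _ _ he; first by rewrite /= gp.
  move=> q d; rewrite !(inE, mem_cat) => /orP[/eqP ->|/(hc _ d)].
    by case: d; rewrite eqxx ?orbT.
  by rewrite mem_cat inE => /or3P[->|->|->]; rewrite ?orbT.
exists V; split=> // q qV; apply: sV; move: qV.
by rewrite !(inE, mem_cat) => /or3P[->|->|->]; rewrite ?orbT.
Qed.

Definition run (w : seq bool) : node := foldl next_node (0, patterns0) w.

Lemma run_rcons w d : run (rcons w d) = next_node (run w) d.
Proof. exact: foldl_rcons. Qed.

Lemma delta_lt q d : delta q d < 77.
Proof.
rewrite /delta; have : nth (0, 0) table q \in (0, 0) :: table.
  have [lt|ge] := ltnP q (size table); first by rewrite inE mem_nth ?orbT.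
  by rewrite nth_default // mem_head.
have : all (fun r => (r.1 < 77) && (r.2 < 77)) ((0, 0) :: table) by [].
by move/allP => h /h; case: (nth _ _ _) => a b /= /andP[]; case: d.
Qed.

Definition automaton : dfa bool :=
  @Dfa bool 'I_77 ord0 [set q : 'I_77 | val q \in accepting]
    (fun q d => Ordinal (delta_lt q d)).

Lemma automaton_acceptE w : dfa_accept automaton w = ((run w).1 \in accepting).
Proof.
have E : val (foldl (@dfa_trans _ automaton) (dfa_init automaton) w) = (run w).1.
  by elim/last_ind: w => // w d IH; rewrite run_rcons foldl_rcons /= IH.
by rewrite /dfa_accept inE E.
Qed.

Lemma all_checksP : all_checks.
Proof. by vm_compute. Qed.

Lemma run_describes w : describes (run w).2 (trib_value w).
Proof.
have /and4P[h0 /eqP hs _ _] := all_checksP.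
elim/last_ind: w => [|w d IH].
  by rewrite trib_value_nil; apply: describes0 h0 hs.
by rewrite run_rcons trib_value_rcons; apply: describes_step.
Qed.

(** The search starts from the nodes of the words 10 and 11, and its visited set is closed under
    both digits. *)
Lemma run_good d w : good (run [:: true, d & w]).
Proof.
have /and4P[_ _ _ /exploreP] := all_checksP.
case=> // V [sV gV cV]; apply: (allP gV).
elim/last_ind: w => [|w e IH]; last by rewrite -!rcons_cons run_rcons cV.
by apply: sV; case: d; rewrite !inE eqxx ?orbT.
Qed.

(** * Factors of the word and rectangles with at least five rows *)

Definition factor (v : seq letter) : Prop :=
  exists u, mkseq TR (size (u ++ v)) = u ++ v.

Lemma factor_subst v : factor v -> factor (trib_subst v).
Proof.
case=> u E; exists (trib_subst u).
by rewrite -trib_subst_cat -E -mkseq_image_size size_mkseq.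
Qed.

Lemma factor_suffix u v : factor (u ++ v) -> factor v.
Proof. by case=> u' E; exists (u' ++ u); rewrite -catA. Qed.

Lemma factor_nth v : factor v ->
  exists p, forall k, k < size v -> TR (p + k) = nth l0 v k.
Proof.
case=> u E; exists (size u) => k lk.
have lt : size u + k < size (u ++ v) by rewrite size_cat ltn_add2l.
by rewrite -(nth_mkseq l0 TR lt) E nth_cat ltnNge leq_addr /= addKn.
Qed.

Lemma iter_subst_cons k a w :
  iter k trib_subst (a :: w) = iter k trib_subst [:: a] ++ iter k trib_subst w.
Proof.
by rewrite -cat1s; elim: k => // k IH; rewrite !iterS IH trib_subst_cat.
Qed.

(* tau^3(0) = 0102010 and tau^3(1) = 010201 end in 0 and 1 again. *)
Lemma factor_pair K : let w := iter (3 * K) trib_subst [:: l0] in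
  factor (l0 :: w) /\ factor (l1 :: w).
Proof.
elim: K => [|K [h0 h1]].
  rewrite muln0; split; last by exists [:: l0]; apply/eqP; vm_compute.
  by exists [:: l0; l1; l0; l2; l0; l1]; apply/eqP; vm_compute.
rewrite mulnS iterD.
have step a v : factor (a :: v) ->
    factor (iter 3 trib_subst [:: a] ++ iter 3 trib_subst v).
  by move=> h; rewrite -iter_subst_cons; do 3!apply: factor_subst.
split; [apply: (@factor_suffix [:: l0; l1; l0; l2; l0; l1])
       | apply: (@factor_suffix [:: l0; l1; l0; l2; l0])].
  exact: step h0.
exact: step h1.
Qed.

(** Apply tau^3 to the two factors of [factor_pair], then drop 01 from 0102010 and 0 from 010201. *)
Lemma long_factors L : exists w, [/\ L <= size w,
  factor ([:: l0; l2; l0; l1; l0] ++ w) & factor ([:: l1; l0; l2; l0; l1] ++ w)].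
Proof.
have [h0 h1] := factor_pair L.
exists (iter 3 trib_subst (iter (3 * L) trib_subst [:: l0])); split.
- by rewrite -iterD; apply: leq_trans (ltnW (size_trib_iter _)); lia.
- apply: (@factor_suffix [:: l0; l1]).
  have := iter_subst_cons 3 l0 (iter (3 * L) trib_subst [:: l0]) => /= <-.
  by do 3!apply: factor_subst.
- apply: (@factor_suffix [:: l0]).
  have := iter_subst_cons 3 l1 (iter (3 * L) trib_subst [:: l0]) => /= <-.
  by do 3!apply: factor_subst.
Qed.

Lemma large_not_balanced m n : 5 <= m -> 5 <= n -> ~ two_balanced m n.
Proof.
move=> m5 n5.
have [w [sw /factor_nth[i hi] /factor_nth[j hj]]] := long_factors (m + n).
(* The excess of zeros in the prefix of length k of 02010w over 10201w. *)
pose D k := if k < 5 then odd k : nat else 1.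
have key k : k <= m + n ->
    pcount 0 (i + k) + pcount 0 j = pcount 0 (j + k) + pcount 0 i + D k.
  elim: k => [|k IH] lk; first by rewrite !addn0 addnC.
  have {}IH := IH (ltnW lk); rewrite !addnS !pcountS /letter_at.
  rewrite hi ?hj ?size_cat; [|lia|lia].
  case: k lk IH => [|[|[|[|[|k]]]]] lk /=; rewrite /D /=; lia.
have sums M p : M + p <= m + n ->
    \sum_(k < M) pcount 0 (i + k + p) + M * pcount 0 j =
    \sum_(k < M) pcount 0 (j + k + p) + M * pcount 0 i + \sum_(k < M) D (k + p).
  have cst x : M * x = \sum_(k < M) x by rewrite sum_nat_const card_ord.
  move=> lM; rewrite !cst -!big_split /=.
  by apply: eq_bigr => k _; rewrite -!addnA key //; have := ltn_ord k; lia.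
have Dn : \sum_(k < m) D (k + n) = m.
  rewrite -[RHS]card_ord -sum1_card.
  by apply: eq_bigr => k _; rewrite /D ltnNge (leq_trans n5) ?leq_addl.
(* [D] takes the values 0, 1, 0, 1, 0 on 0, ..., 4, with sum 2 instead of 5; this deficit of 3 is
   the difference of the two counts. *)
have D0 : \sum_(k < m) D (k + 0) + 3 = m.
  rewrite -(subnKC m5) big_split_ord /= addnAC; congr (_ + _).
    by rewrite !big_ord_recr big_ord0.
  rewrite -[RHS]card_ord -sum1_card.
  by apply: eq_bigr => k _; rewrite /D addn0.
move/two_balancedP/(_ i j l0).
have := count_rectangle m n i l0; have := count_rectangle m n j l0.
have := sums m n (leqnn _); have := sums m 0; rewrite addn0 leq_addr Dn.
have E x : \sum_(k < m) pcount 0 (x + k + 0) = \sum_(k < m) pcount 0 (x + k).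
  by apply: eq_bigr => k _; rewrite addn0.
by rewrite -[nat_of_ord l0]/0 !E => /(_ isT); lia.
Qed.

(** * The three ranges of m *)

Lemma trib_value_surj2 n : 2 <= n ->
  exists d w, trib_value [:: true, d & w] = n.
Proof.
move=> n2; have [[|d w] E] := trib_value_surj (ltnW n2); last by exists d, w.
by move: n2; rewrite -E trib_value_true.
Qed.

Lemma balance_trib_value d w n : trib_value [:: true, d & w] = n ->
  [/\ two_balanced 1 n,
      (run [:: true, d & w]).1 \in accepting <-> two_balanced 2 n &
      forall (e : bool) m, (m == 3) || (m == 4) ->
        ~ two_balanced m (image_size n + e)].
Proof.
move=> En; have := run_describes [:: true, d & w]; rewrite En => hD.
have /and3P[g1 /eqP g2 /and3P[/andP[f3 f4] /andP[t3 t4] _]] := run_good d w.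
split.
- by apply/(balancedP hD (count1P n)).
- by rewrite -g2; apply/(balancedP hD (count2P n)).
- by move=> e m hm; apply: (unbalancedP hm hD.1); case/orP: hm => /eqP ->; case: e.
Qed.

Theorem theorem10 :
  (forall n : nat, 1 <= n -> two_balanced 1 n) /\
  (exists M : dfa bool, #|dfa_state M| = 77 /\
     forall (n : nat) (w : seq bool), 2 <= n -> trib_rep n w ->
       (dfa_accept M w <-> two_balanced 2 n)) /\
  (forall m n : nat, 3 <= m -> m <= n -> ~ two_balanced m n).
Proof.
split; [|split].
- move=> n n1; have [n2|n2] := ltnP 1 n; last first.
    have -> : n = 1 by lia.
    apply/two_balancedP => i j c.
    have := count_rectangle 1 1 i c; have := count_rectangle 1 1 j c.
    by rewrite !big_ord_recr !big_ord0 /= !addn0 !addn1 !pcountS; lia.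
  by have [d [w /balance_trib_value[]]] := trib_value_surj2 n2.
- exists automaton; split; first exact: card_ord.
  move=> n w n2 /and3P[hd _ /eqP Ew]; rewrite automaton_acceptE.
  case: w hd Ew => [|[] [|d w]] // _ Ew.
  + by move: n2; rewrite -Ew trib_value_nil.
  + by move: n2; rewrite -Ew trib_value_true.
  + by have [] := balance_trib_value Ew.
- move=> m n m3 mn; have [m5|m5] := leqP 5 m.
    by apply: large_not_balanced => //; apply: leq_trans mn.
  have hm : (m == 3) || (m == 4) by lia.
  (* The imbalance test at a node concerns the children of its number, so n is traced back to its
     parent p. *)
  have [p [u [En _ pn]]] := image_size_cover n.
  have [p2|p2] := leqP 2 p.
    have [d [w /balance_trib_value[_ _ H]]] := trib_value_surj2 p2.
    by rewrite En; apply: H.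
  have := pcount_sum p; have := image_sizeE p => sE sp.
  have [p1 [u1 m1]] : p = 1 /\ u = true /\ m = 3.
    by move: En pn; case: u; lia.
  have [hr _] := run_describes [:: true].
  have /and4P[_ _ h _] := all_checksP.
  move: hr; rewrite trib_value_true En m1 u1 p1 => hr.
  exact: (@unbalancedP 3 true _ _ isT hr h).
Qed.
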